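(* Let $(\tau,X)$ be a pair of (generally correlated) real random variables with $\tau>0$ almost surely, and let $S(\cdot)$ be the associated renewal-reward process. Assume that $\mathbb{E}\exp(\varepsilon X^2-\tau)<\infty$ for some $\varepsilon>0$, and that $\mathbb{E}X=0$, $\mathbb{E}X^2=1$, $\mathbb{E}\tau=1$. Then \[ \lim_{x\to\infty,\;x/\sqrt t\to 0}\ \frac1{x^2}\ln \mathbb{P}\bigl(S(t)>x\sqrt t\bigr)=-\frac12 , \] that is, for every $\epsilon'>0$ there exists $\delta>0$ such that for all $t>0$, $x>0$ satisfying $x>1/\delta$ and $x/\sqrt t<\delta$, \[ \Bigl|\frac1{x^2}\ln \mathbb{P}\bigl(S(t)>x\sqrt t\bigr)+\frac12\Bigr|\le\epsilon' . \]
   Context: Renewal-reward process: let $(\tau_1,X_1),(\tau_2,X_2),\dots$ be independent copies of the pair $(\tau,X)$. For $t\ge 0$, $S(t)=X_1+\dots+X_n$ whenever $\tau_1+\dots+\tau_n\le t<\tau_1+\dots+\tau_{n+1}$, $n=0,1,2,\dots$ (empty sums are $0$). This defines $S(t)$ for all $t\ge0$ almost surely. *)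

(* Defs.v *)
From HB Require Import structures.
From mathcomp Require Import all_boot all_order all_algebra.
From mathcomp Require Import all_classical all_reals all_analysis.

Set Implicit Arguments.
Unset Strict Implicit.
Unset Printing Implicit Defensive.

Import Order.TTheory GRing.Theory Num.Theory.
Import numFieldNormedType.Exports.

Local Open Scope classical_set_scope.
Local Open Scope ring_scope.

Definition mutually_independent d (T : measurableType d) (R : realType)
    (P : probability T R) d' (E : measurableType d') (Y : nat -> T -> E) : Prop :=
  forall (J : seq nat) (B : nat -> set E), uniq J ->
    (forall i, measurable (B i)) ->
    P [set w | forall i, i \in J -> B i (Y i w)] =
    (\prod_(i <- J) P (Y i @^-1` B i))%E.

(* The copies may live on a probability space different from that of [Y0]. *)
Definition independent_copies
    d0 (T0 : measurableType d0) d (T : measurableType d) (R : realType)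
    (P0 : probability T0 R) (P : probability T R)
    d' (E : measurableType d') (Y0 : T0 -> E) (Y : nat -> T -> E) : Prop :=
  mutually_independent P Y /\
  forall i (B : set E), measurable B -> P (Y i @^-1` B) = P0 (Y0 @^-1` B).

(* [tau i] and [X i] are the (i+1)-st waiting time and reward. The values of [S]
   at negative times, and on an event of probability 0, are unconstrained. *)
Definition renewal_reward_process d (T : measurableType d) (R : realType)
    (P : probability T R) (tau X : nat -> {RV P >-> R})
    (S : R -> {RV P >-> R}) : Prop :=
  {ae P, forall w, forall (t : R) (n : nat), 0 <= t ->
    \sum_(i < n) tau i w <= t < \sum_(i < n.+1) tau i w ->
    S t w = \sum_(i < n) X i w}.
Arguments renewal_reward_process {d T R} P tau X S.

(* Main.v *)
From HB Require Import structures.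
Require Import Defs.
From mathcomp Require Import all_boot all_order all_algebra.
From mathcomp Require Import all_classical all_reals all_analysis.
From mathcomp Require Import measurable_realfun ring lra.

Import Order.TTheory GRing.Theory Num.Theory.
Import numFieldNormedType.Exports.

Local Open Scope classical_set_scope.
Local Open Scope ring_scope.

Set Implicit Arguments.
Unset Strict Implicit.
Unset Printing Implicit Defensive.

(** Put l = x / sqrt t, so that x sqrt t = l t and x^2 = l^2 t. The claim is that
P(S(t) > l t) = exp (- l^2 t (1/2 + o(1))) when l -> 0 and l^2 t -> oo. Write
S_k and T_k for the sums of the first k rewards and waiting times.

The only analytic input is the expansion, for fixed p and q > 0,
  ln E exp (p l X - q l^2 tau) = l^2 (p^2 / 2 - q + o(1))     as l -> 0
([exp_moment_asymptotics]). It needs nothing beyond the given moments, because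
the negative term - q l^2 tau has the same order as the square of l X, and
p l |X| is at most a constant plus a small multiple of q l^2 X^2; dominated
convergence then applies.

By independence, the products over i < k of exp (p l X_i - q l^2 tau_i - g l^2)
form a supermartingale in k as soon as g is slightly larger than p^2 / 2 - q.
The only probabilistic input is a maximal inequality for two such products
([weighted_maximal_inequality]): if the W_k have expectation 1 and the M_k are
a supermartingale started at 1, then under the law of density W_n the
probability that M_k >= c W_k for some k <= n is at most 1 / c.

Upper bound ([upper_tail_bound]). Take W = 1, p = 1 and q = 1/2 + eps. If
T_k <= t and S_k > l t for some k, in particular for the number of renewals
before t, then exp (l S_k - q l^2 T_k) > exp (l^2 t (1/2 - eps)).

Lower bound ([lower_tail_bound]). Take for W_n the product with p = 1 + 4 eta,
q = p^2 / 2 and with g chosen to make its expectation exactly 1. Under the law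
of density W_n the rewards have drift about p l, and waiting times still have
mean about 1. Instead of proving laws of large numbers for that law, one
compares W with four further products; outside a set of weighted mass at most
1/2 this gives, for suitable m close to (1 - eta) t and n close to (1 + eta) t,
  T_m <= t < T_n,   S_k > l t for m <= k <= n,   W_n <= exp ((1/2 + 11 eta) l^2 t).
There the number of renewals before t lies between m and n, hence S(t) > l t,
and removing the density costs the factor exp (- (1/2 + 11 eta) l^2 t). *)

(** * Products of independent factors and a maximal inequality *)

Section independence.
Context (d : measure_display) (T : measurableType d) (R : realType).
Context (d' : measure_display) (E : measurableType d').
Variables (P : probability T R) (Y : nat -> T -> E).
Hypotheses (mY : forall i, measurable_fun setT (Y i))
           (indepY : mutually_independent P Y).
Local Open Scope ereal_scope.

Let measurable_preY i B : measurable B -> measurable (Y i @^-1` B).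
Proof. by move=> mB; rewrite -[X in measurable X]setTI; exact: mY. Qed.

(** Rectangles in the first [k] coordinates: independence is a statement about
them, and they form a pi-system. *)
Definition cylinders (k : nat) : set (set T) :=
  [set A | exists2 B : nat -> set E, (forall i, measurable (B i)) &
     A = [set w | forall i, i \in iota 0 k -> B i (Y i w)]].

Local Notation past k := (g_sigma_algebraType (cylinders k)).

Lemma cylinders_measurable k : cylinders k `<=` measurable.
Proof.
move=> _ [B mB ->].
rewrite (_ : [set _ | _] = \bigcap_(i in [set` iota 0 k]) (Y i @^-1` B i)).
  by apply: bigcap_measurableType => i _; exact: measurable_preY.
by apply/seteqP; split.
Qed.

Lemma past_measurable k (A : set (past k)) :
  measurable A -> measurable (A : set T).
Proof.
exact: (smallest_sub (@sigma_algebra_measurable _ T) (@cylinders_measurable k)).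
Qed.

Lemma measurable_to_past k : measurable_fun setT (idfun : T -> past k).
Proof. by move=> _ A mA; rewrite setTI; exact: (past_measurable mA). Qed.

Lemma measurable_from_past k i : (i < k)%N ->
  measurable_fun (setT : set (past k)) (Y i).
Proof.
move=> ik _ B mB; rewrite setTI; apply: sub_sigma_algebra.
exists (fun j => if j == i then B else setT) => [j|].
  by case: ifP.
apply/seteqP; split => [w Bw j _|w /(_ i)] /=.
  by case: ifPn => // /eqP ->.
by rewrite eqxx mem_iota; exact.
Qed.

(** Both sides are finite measures in [A], and on cylinders they agree by the
product rule; a pi-system determines a finite measure. *)
Lemma past_independent k (A : set (past k)) B :
  measurable A -> measurable B ->
  P (A `&` Y k @^-1` B) = P A * P (Y k @^-1` B).
Proof.
move=> mA mB.
have mYB := measurable_preY k mB.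
have r0 : (0 <= fine (P (Y k @^-1` B)))%R by rewrite fine_ge0.
pose m2 := mscale (NngNum r0) P.
have m2E X : m2 X = P X * P (Y k @^-1` B).
  by rewrite /m2 /mscale /= fineK ?fin_num_measure// muleC.
have m1E X : mrestr P mYB X = P (X `&` Y k @^-1` B) by [].
rewrite -m2E -[LHS]/(mrestr P mYB A).
pose G := [set X | cylinders k X /\ X `<=` setT].
have GE : G = cylinders k.
  by apply/seteqP; split => [X []//|X]; split.
apply: (g_sigma_algebra_measure_unique_trace (cylinders k) setT) => //.
- by rewrite -/G GE; exact: cylinders_measurable.
- rewrite -/G GE => _ _ [B1 mB1 ->] [B2 mB2 ->].
  exists (fun i => B1 i `&` B2 i) => [i|]; first exact: measurableI.
  apply/seteqP; split => [w [h1 h2] i ik|w h]; first by split; [exact: h1|exact: h2].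
  by split => i /h [].
- by rewrite [LHS]m1E [RHS]m2E setTI probability_setT mul1e.
- rewrite -/G GE => _ [C mC ->]; rewrite [LHS]m1E [RHS]m2E.
  pose C' i := if i == k then B else C i.
  have mC' i : measurable (C' i) by rewrite /C'; case: ifP.
  have u n : uniq (iota 0 n) by exact: iota_uniq.
  have := indepY (u k.+1) mC'; have := indepY (u k) mC.
  rewrite -[k.+1]addn1 iotaD big_cat big_seq1 /= add0n => -> /=.
  have -> : C' k = B by rewrite /C' eqxx.
  move=> eqk.
  rewrite (eq_big_seq (fun i => P (Y i @^-1` C' i))); last first.
    move=> i; rewrite mem_iota /= add0n => ik.
    by rewrite /C' (ltn_eqF ik).
  rewrite -eqk; congr (P _); apply/seteqP; split => w /=.
    move=> [h Bw] i; rewrite mem_cat mem_seq1 mem_iota /= add0n => /orP[ik|/eqP->].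
      by rewrite /C' (ltn_eqF ik); apply: h; rewrite mem_iota.
    by rewrite /C' eqxx.
  move=> h; split.
    move=> i ik; have := h i; rewrite mem_cat ik => /(_ isT).
    by move: ik; rewrite mem_iota /= add0n /C' => /ltn_eqF ->.
  by have := h k; rewrite mem_cat mem_seq1 eqxx orbT /C' eqxx; exact.
- by rewrite [X in X < _]m1E setTI (le_lt_trans (probability_le1 _ mYB))// ltey.
- by rewrite -/G GE.
Qed.

(** The joint law of the past and of [Y k] is a product measure by
[past_independent], so the factorization is Tonelli's theorem. *)
Lemma expectation_past_mul k (G : past k -> \bar R) (f : E -> \bar R) :
  measurable_fun setT G -> (forall w, 0 <= G w) ->
  measurable_fun setT f -> (forall y, 0 <= f y) ->
  \int[P]_w (G w * f (Y k w)) = \int[P]_w G w * \int[P]_w f (Y k w).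
Proof.
move=> mG G0 mf f0.
pose XY : {mfun T >-> past k} := HB.pack (idfun : T -> past k)
  (isMeasurableFun.Build _ _ _ _ _ (@measurable_to_past k)).
pose YY : {mfun T >-> E} := HB.pack (Y k)
  (isMeasurableFun.Build _ _ _ _ _ (mY k)).
pose Z : T -> (past k * E)%type := fun w => (w : past k, Y k w).
have mZ : measurable_fun setT Z.
  by apply/measurable_fun_pairP; split; [exact: measurable_to_past|exact: mY].
pose ZZ : {mfun T >-> (past k * E)%type} := HB.pack Z
  (isMeasurableFun.Build _ _ _ _ _ mZ).
pose g (z : past k * E) := G z.1 * f z.2.
have mg : measurable_fun setT g.
  apply: emeasurable_funM.
    by apply: (measurableT_comp mG); exact: measurable_fst.
  by apply: (measurableT_comp mf); exact: measurable_snd.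
have g0 z : 0 <= g z by rewrite mule_ge0.
rewrite -[LHS](@ge0_integral_distribution _ _ _ _ _ P ZZ g)//.
have PZ X : measurable X -> (distribution P XY \x distribution P YY) X = distribution P ZZ X.
  apply: product_measure_unique => A B mA mB.
  exact: past_independent.
rewrite (eq_measure_integral (distribution P XY \x distribution P YY)%E); last first.
  by move=> X mX _; rewrite /= PZ.
rewrite fubini_tonelli1//= /fubini_F /g /=.
under eq_integral do rewrite ge0_integralZl//.
rewrite ge0_integralZr//; last exact: integral_ge0.
by rewrite !ge0_integral_distribution.
Qed.

Let measurable_of_past k d'' (U : measurableType d'') (f : past k -> U) :
  measurable_fun setT f -> measurable_fun (setT : set T) f.
Proof. by move=> mf; exact: (measurableT_comp mf (@measurable_to_past k)). Qed.

Local Open Scope ring_scope.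

Definition weight (u : E -> R) (n : nat) (x : T) : R := \prod_(i < n) u (Y i x).

Lemma weightS u n x : weight u n.+1 x = weight u n x * u (Y n x).
Proof. by rewrite /weight big_ord_recr. Qed.

Lemma weight_ge0 u n x : (forall y, 0 <= u y) -> 0 <= weight u n x.
Proof. by move=> u0; apply: prodr_ge0 => i _; exact: u0. Qed.

Lemma weight_past_measurable u k n : measurable_fun setT u -> (k <= n)%N ->
  measurable_fun (setT : set (past n)) (weight u k).
Proof.
move=> mu kn; rewrite /weight.
apply: (@measurable_prod _ (past n) R setT _ (index_enum 'I_k) (fun i x => u (Y i x))) => i _.
apply: (measurableT_comp mu); apply: measurable_from_past.
exact: leq_trans (ltn_ord i) kn.
Qed.

Lemma weight_measurable u n : measurable_fun setT u ->
  measurable_fun setT (weight u n).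
Proof.
move=> mu.
exact: (@measurable_of_past n _ _ (weight u n) (weight_past_measurable mu (leqnn n))).
Qed.

Lemma expectation_weight (w : E -> R) n :
  measurable_fun setT w -> (forall y, 0 <= w y) ->
  (forall i, \int[P]_x (w (Y i x))%:E = 1)%E ->
  (\int[P]_x (weight w n x)%:E = 1)%E.
Proof.
move=> mw w0 Ew; elim: n => [|n IHn].
  under eq_integral do rewrite /weight big_ord0.
  by rewrite integral_cst// mul1e; exact: probability_setT.
under eq_integral do rewrite weightS EFinM.
rewrite (@expectation_past_mul n (EFin \o weight w n) (EFin \o w))//=.
- by rewrite IHn Ew mule1.
- by apply/measurable_EFinP; exact: weight_past_measurable.
- by move=> x; rewrite lee_fin weight_ge0.
- exact/measurable_EFinP.
Qed.

Definition crossed (w m : E -> R) (c : R) (n : nat) (x : T) : bool :=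
  has (fun k => c * weight w k x <= weight m k x) (iota 0 n.+1).

Lemma crossedP w m c n x : reflect
  (exists2 k, (k <= n)%N & c * weight w k x <= weight m k x)
  (crossed w m c n x).
Proof.
apply: (iffP hasP) => [[k]|[k kn h]].
  by rewrite mem_iota => /andP[_ kn] h; exists k.
by exists k => //; rewrite mem_iota.
Qed.

Lemma crossedS w m c n x : crossed w m c n.+1 x =
  crossed w m c n x || (c * weight w n.+1 x <= weight m n.+1 x).
Proof. by rewrite /crossed -[n.+2]addn1 iotaD has_cat /= orbF. Qed.

Lemma crossed_past_measurable w m c n :
  measurable_fun setT w -> measurable_fun setT m ->
  measurable_fun (setT : set (past n)) (crossed w m c n).
Proof.
move=> mw mm.
suff : forall s, {in s, forall k, k <= n}%N ->
    measurable_fun (setT : set (past n))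
     (fun x => has (fun k => c * weight w k x <= weight m k x) s).
  by apply => k; rewrite mem_iota => /andP[_].
elim=> [_|k s IHs sn] /=; first exact: measurable_cst.
apply: measurable_or; last first.
  by apply: IHs => i si; apply: sn; rewrite inE si orbT.
have kn : (k <= n)%N by apply: sn; rewrite mem_head.
apply: measurable_fun_ler; last exact: weight_past_measurable.
by apply: measurable_funM => //; exact: weight_past_measurable.
Qed.

Lemma crossed_measurable w m c n :
  measurable_fun setT w -> measurable_fun setT m ->
  measurable_fun setT (crossed w m c n).
Proof.
move=> mw mm; have := @crossed_past_measurable w m c n mw mm.
exact: (@measurable_of_past n).
Qed.

(** Ville's inequality for the ratio of the weights of [m] and [w] under the law
of density [weight w n]. Stop at the first crossing: the process equal to the
weight of [m] before the crossing and to [c] times that of [w] from then on is a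
supermartingale, since it only drops at the crossing time. Its expectation is at
most 1, and bounds [c] times the integral in question. *)
Lemma weighted_maximal_inequality (w m : E -> R) (c : R) (n : nat) :
  measurable_fun setT w -> (forall y, 0 <= w y) ->
  measurable_fun setT m -> (forall y, 0 <= m y) ->
  (forall i, \int[P]_x (w (Y i x))%:E = 1)%E ->
  (forall i, \int[P]_x (m (Y i x))%:E <= 1)%E -> 0 < c ->
  (\int[P]_x (if crossed w m c n x then weight w n x else 0)%:E <= c^-1%:E)%E.
Proof.
move=> mw w0 mm m0 Ew Em c0.
pose G1 k x := if crossed w m c k x then c * weight w k x else 0.
pose G2 k x := if crossed w m c k x then 0 else weight m k x.
have G1_ge0 k x : 0 <= G1 k x.
  by rewrite /G1; case: ifP => // _; rewrite mulr_ge0 ?weight_ge0// ltW.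
have G2_ge0 k x : 0 <= G2 k x by rewrite /G2; case: ifP => // _; rewrite weight_ge0.
have pG1 k : measurable_fun (setT : set (past k)) (G1 k).
  apply: measurable_fun_ifT; [exact: crossed_past_measurable| |exact: measurable_cst].
  by apply: measurable_funM => //; exact: weight_past_measurable.
have pG2 k : measurable_fun (setT : set (past k)) (G2 k).
  apply: measurable_fun_ifT; [exact: crossed_past_measurable|exact: measurable_cst|].
  exact: weight_past_measurable.
have mG1 k : measurable_fun (setT : set T) (G1 k) by exact: (@measurable_of_past k).
have mG2 k : measurable_fun (setT : set T) (G2 k) by exact: (@measurable_of_past k).
(* one more factor is independent of the past, including the crossing event *)
have step k : (\int[P]_x (G1 k.+1 x)%:E + \int[P]_x (G2 k.+1 x)%:E <=
               \int[P]_x (G1 k x)%:E + \int[P]_x (G2 k x)%:E)%E.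
  have mwY i : measurable_fun setT (fun x => w (Y i x)) by exact: measurableT_comp.
  have mmY i : measurable_fun setT (fun x => m (Y i x)) by exact: measurableT_comp.
  rewrite -ge0_integralD//; [|by move=> x _; rewrite lee_fin|exact/measurable_EFinP
    |by move=> x _; rewrite lee_fin|exact/measurable_EFinP].
  apply: (@le_trans _ _ (\int[P]_x ((G1 k x)%:E * (w (Y k x))%:E
                                  + (G2 k x)%:E * (m (Y k x))%:E))%E).
    apply: ge0_le_integral => //.
    - by move=> x _; rewrite -EFinD lee_fin addr_ge0.
    - by apply/measurable_EFinP; exact: measurable_funD.
    - by apply/measurable_EFinP; apply: measurable_funD; apply: measurable_funM.
    - move=> x _; rewrite -!EFinM -!EFinD lee_fin /G1 /G2 crossedS !weightS.
      case: (crossed w m c k x) => /=; first by rewrite mulrA mul0r.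
      by case: ifPn => h; rewrite ?mul0r ?add0r ?addr0.
  rewrite ge0_integralD//; last 4 first.
  - by move=> x _; rewrite -EFinM lee_fin mulr_ge0.
  - by apply/measurable_EFinP; exact: measurable_funM.
  - by move=> x _; rewrite -EFinM lee_fin mulr_ge0.
  - by apply/measurable_EFinP; exact: measurable_funM.
  apply: leeD.
  - rewrite (@expectation_past_mul k (EFin \o G1 k) (EFin \o w))//=.
    + by rewrite Ew mule1.
    + exact/measurable_EFinP.
    + by move=> x; rewrite lee_fin.
    + exact/measurable_EFinP.
  - rewrite (@expectation_past_mul k (EFin \o G2 k) (EFin \o m))//=.
    + by rewrite -[leRHS]mule1 lee_wpmul2l// integral_ge0// => x _; rewrite lee_fin.
    + exact/measurable_EFinP.
    + by move=> x; rewrite lee_fin.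
    + exact/measurable_EFinP.
have G_le1 : (\int[P]_x (G1 n x)%:E + \int[P]_x (G2 n x)%:E <= 1)%E.
  elim: n => [|n IHn]; last exact: le_trans (step n) IHn.
  rewrite -ge0_integralD//; [|by move=> x _; rewrite lee_fin|exact/measurable_EFinP
    |by move=> x _; rewrite lee_fin|exact/measurable_EFinP].
  rewrite -[leRHS](probability_setT P) -[leRHS]mul1e -integral_cst//.
  apply: ge0_le_integral => //.
  - by move=> x _; rewrite -EFinD lee_fin addr_ge0.
  - by apply/measurable_EFinP; exact: measurable_funD.
  - move=> x _; rewrite -EFinD lee_fin /G1 /G2 /crossed /= orbF /weight !big_ord0.
    by case: ifP => //; rewrite ?add0r ?addr0.
have G1_le1 : (\int[P]_x (G1 n x)%:E <= 1)%E.
  by apply: le_trans G_le1; rewrite leeDl// integral_ge0// => x _; rewrite lee_fin.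
rewrite -(@lee_pmul2l _ c%:E)//.
rewrite -EFinM mulfV ?gt_eqF// -ge0_integralZl//; last 3 first.
- apply/measurable_EFinP; apply: measurable_fun_ifT; [exact: crossed_measurable| |exact: measurable_cst].
  exact: weight_measurable.
- by move=> x _; rewrite lee_fin; case: ifP => // _; rewrite weight_ge0.
- by rewrite lee_fin ltW.
rewrite (_ : (\int[P]_x _)%E = (\int[P]_x (G1 n x)%:E)%E)//.
by apply: eq_integral => x _; rewrite -EFinM /G1; case: ifP => //; rewrite mulr0.
Qed.

End independence.

(** * Second-order expansion of exponential moments *)

Section exp_expansion.
Variable R : realType.
Implicit Types p q eps l x t y : R.

(** In the remainder of the exponential series, [k + n]! is at least [k]!. *)
Lemma expR_taylor_bound n y :
  `|expR y - \sum_(k < n) (y ^+ k / k`!%:R)| <= `|y| ^+ n * expR `|y|.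
Proof.
pose u (N : nat) := `|series (exp_coeff y) N - \sum_(k < n) (y ^+ k / k`!%:R)|.
have ucvg : u @ \oo --> `|expR y - \sum_(k < n) (y ^+ k / k`!%:R)|.
  apply: cvg_norm; apply: cvgB; [exact: is_cvg_series_exp_coeff|exact: cvg_cst].
rewrite -(cvg_lim _ ucvg)//; apply: limr_le; first by apply/cvg_ex; eexists; exact: ucvg.
near=> N.
have nN : (n <= N)%N by near: N; exact: nbhs_infty_ge.
rewrite /u /series /= -(big_mkord xpredT (fun k => y ^+ k / k`!%:R)).
rewrite (big_cat_nat (n := n))//= addrAC subrr add0r.
apply: (le_trans (ler_norm_sum _ _ _)).
rewrite -{1}[n]add0n big_addn.
apply: (@le_trans _ _ (\sum_(0 <= i < N - n) (`|y| ^+ n * exp_coeff `|y| i))).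
  apply: ler_sum => i _; rewrite /exp_coeff /= normrM normrX exprD.
  rewrite [X in X * _ <= _]mulrC -mulrA ler_wpM2l ?exprn_ge0// ler_wpM2l ?exprn_ge0//.
  rewrite normfV ger0_norm// lef_pV2 ?posrE ?ltr0n ?fact_gt0// ler_nat.
  by rewrite leq_fact// leq_addr.
rewrite -mulr_sumr ler_wpM2l ?exprn_ge0//.
apply: (nondecreasing_cvgn_le _ (is_cvg_series_exp_coeff `|y|) (N - n)).
by apply: nondecreasing_series => i _ _; exact: exp_coeff_ge0.
Unshelve. all: by end_near. Qed.

Lemma expR_taylor1 y : `|expR y - 1 - y| <= y ^+ 2 * expR `|y|.
Proof.
have := expR_taylor_bound 2 y.
by rewrite !big_ord_recr big_ord0 /= add0r !divr1 expr0 expr1 opprD addrA real_normK ?num_real.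
Qed.

Lemma expR_taylor2 y : `|expR y - 1 - y - y ^+ 2 / 2| <= `|y| ^+ 3 * expR `|y|.
Proof.
have := expR_taylor_bound 3 y.
by rewrite !big_ord_recr big_ord0 /= add0r !divr1 expr0 expr1 !opprD !addrA.
Qed.

(** Subtracting the term linear in [l], whose mean vanishes for a centred reward,
makes the quotient of order 1 as [l] tends to 0. *)
Definition exp_quotient p q x t l :=
  (expR (p * l * x - q * l ^+ 2 * t) - 1 - p * l * x) / l ^+ 2.

Lemma exp_quotient_cvg p q x t : exists C, forall l, 0 < l <= 1 ->
  `|exp_quotient p q x t l - (p ^+ 2 * x ^+ 2 / 2 - q * t)| <= C * l.
Proof.
pose a := p * x; pose b := q * t; pose K := `|a| + `|b|.
exists (K ^+ 3 * expR K + `|a| * `|b| + b ^+ 2 / 2) => l /andP[l0 l1].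
rewrite /exp_quotient.
pose y := p * l * x - q * l ^+ 2 * t.
have yE : y = a * l - b * l ^+ 2 by rewrite /y /a /b; ring.
have K0 : 0 <= K by rewrite addr_ge0.
have yK : `|y| <= K * l.
  rewrite yE (le_trans (ler_normB _ _))// (normrM a) (normrM b).
  rewrite normrX (ger0_norm (ltW l0)) mulrDl lerD2l expr2 mulrA ler_piMr//.
  by rewrite mulr_ge0// ltW.
have l20 : 0 < l ^+ 2 by rewrite exprn_gt0.
have -> : (expR (p * l * x - q * l ^+ 2 * t) - 1 - p * l * x) / l ^+ 2 -
    (p ^+ 2 * x ^+ 2 / 2 - q * t) =
    (expR y - 1 - y - y ^+ 2 / 2) / l ^+ 2 + (- (a * b) * l + b ^+ 2 / 2 * l ^+ 2).
  rewrite -/y; set ey := expR y; rewrite yE /a /b; field; exact: lt0r_neq0.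
apply: (le_trans (ler_normD _ _)).
rewrite -[X in _ <= X * _]addrA [leRHS]mulrDl; apply: lerD.
  rewrite normrM normfV (ger0_norm (ltW l20)) ler_pdivrMr//.
  apply: (le_trans (expR_taylor2 y)).
  have -> : K ^+ 3 * expR K * l * l ^+ 2 = (K * l) ^+ 3 * expR K by ring.
  apply: ler_pM; rewrite ?exprn_ge0 ?expR_ge0//.
    by rewrite lerXn2r// nnegrE ?mulr_ge0// ltW.
  by rewrite ler_expR (le_trans yK)// ler_piMr.
apply: (le_trans (ler_normD _ _)); rewrite [leRHS]mulrDl; apply: lerD.
  by rewrite normrM normrN normrM (ger0_norm (ltW l0)).
have h : 0 <= b ^+ 2 / 2 by rewrite divr_ge0// sqr_ge0.
rewrite (ger0_norm (mulr_ge0 h (ltW l20))).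
by rewrite ler_wpM2l// expr2 ler_piMr// ltW.
Qed.

Definition quotient_bound p q eps x t :=
  p ^+ 2 * expR (p ^+ 2 / (2 * q * eps)) *
    (x ^+ 2 + 2 / eps * expR (eps * x ^+ 2 - t))
  + q * t + (q * t + p ^+ 2 * x ^+ 2) / 2.

(** The integrable bound, uniform in small [l]. The increment of [exp (p l x)] is
quadratic in [x] up to the factor [exp (p l |x|)], which the damping
[exp (- q l^2 t)] turns into the given exponential moment. The increment [r] of
the damping factor is at most 1 and at most [q l^2 t], which keeps [t] to the
first power. *)
Lemma exp_quotient_le p q eps x t l : 0 < q -> 0 < eps -> 0 <= t ->
  0 < l -> q * l ^+ 2 <= 1 ->
  `|exp_quotient p q x t l| <= quotient_bound p q eps x t.
Proof.
move=> q0 eps0 t0 l0 ql1.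
have l20 : 0 < l ^+ 2 by rewrite exprn_gt0.
pose y := p * l * x; pose r := 1 - expR (- (q * l ^+ 2 * t)).
have z0 : 0 <= q * l ^+ 2 * t by rewrite mulr_ge0// mulr_ge0// ltW.
have r0 : 0 <= r by rewrite subr_ge0 expR_le1 oppr_le0.
have r1 : r <= 1 by rewrite /r lerBlDr lerDl expR_ge0.
have rz : r <= q * l ^+ 2 * t.
  by have := expR_ge1Dx (- (q * l ^+ 2 * t)); rewrite /r; lra.
have -> : exp_quotient p q x t l =
  expR (- (q * l ^+ 2 * t)) * (expR y - 1 - y) / l ^+ 2 - r / l ^+ 2 - r * y / l ^+ 2.
  rewrite /exp_quotient -/y expRD /r; field; exact: lt0r_neq0.
apply: (le_trans (ler_normB _ _)); apply: lerD; last first.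
  rewrite normrM normfV (ger0_norm (ltW l20)) normrM (ger0_norm r0) ler_pdivrMr//.
  have h : r * `|y| <= (r ^+ 2 + y ^+ 2) / 2.
    rewrite -(real_normK (num_real y)); have := sqr_ge0 (r - `|y|).
    by rewrite sqrrB; lra.
  apply: (le_trans h).
  have r2 : r ^+ 2 <= r by rewrite expr2 ler_piMr.
  have -> : (q * t + p ^+ 2 * x ^+ 2) / 2 * l ^+ 2 = (q * l ^+ 2 * t + y ^+ 2) / 2.
    by rewrite /y; ring.
  by rewrite ler_pM2r// lerD2r (le_trans r2).
apply: (le_trans (ler_normB _ _)); apply: lerD; last first.
  rewrite (ger0_norm (divr_ge0 r0 (ltW l20))).
  by rewrite ler_pdivrMr//; apply: (le_trans rz); rewrite le_eqVlt; apply/orP; left; apply/eqP; ring.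
rewrite normrM normfV (ger0_norm (ltW l20)) normrM ger0_norm ?expR_ge0//.
rewrite ler_pdivrMr//.
apply: (@le_trans _ _ (expR (- (q * l ^+ 2 * t)) * (y ^+ 2 * expR `|y|))).
  by rewrite ler_wpM2l ?expR_ge0// expR_taylor1.
have -> : expR (- (q * l ^+ 2 * t)) * (y ^+ 2 * expR `|y|) =
   p ^+ 2 * l ^+ 2 * (x ^+ 2 * expR (`|y| - q * l ^+ 2 * t)).
  by rewrite [expR (`|y| - _)]expRD /y; ring.
have -> : p ^+ 2 * expR (p ^+ 2 / (2 * q * eps)) * (x ^+ 2 + 2 / eps * expR (eps * x ^+ 2 - t)) * l ^+ 2 =
   p ^+ 2 * l ^+ 2 * (expR (p ^+ 2 / (2 * q * eps)) * (x ^+ 2 + 2 / eps * expR (eps * x ^+ 2 - t))).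
  by ring.
rewrite (ler_wpM2l (mulr_ge0 (sqr_ge0 p) (sqr_ge0 l)))//.
(* l |x| and |p| are decoupled by the inequality between the arithmetic and
   geometric means, weighted so that the square of l |x| contributes only half of
   q l^2 eps x^2; the other half absorbs the factor x^2 below *)
have amgm : `|y| <= p ^+ 2 / (2 * q * eps) + q * l ^+ 2 * (eps * x ^+ 2 / 2).
  have qe : 0 < 2 * q * eps by rewrite !mulr_gt0.
  rewrite -(@ler_pM2r _ (2 * q * eps))// [leRHS]mulrDl divfK ?gt_eqF//.
  have -> : `|y| = `|p| * l * `|x| by rewrite /y !normrM (ger0_norm (ltW l0)).
  rewrite -(real_normK (num_real p)) -(real_normK (num_real x)).
  have := sqr_ge0 (`|p| - q * eps * l * `|x|).
  have -> : (`|p| - q * eps * l * `|x|) ^+ 2 = `|p| ^+ 2 +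
    q * l ^+ 2 * (eps * `|x| ^+ 2 / 2) * (2 * q * eps) - `|p| * l * `|x| * (2 * q * eps).
    by field.
  by lra.
pose v := eps * x ^+ 2 / 2 - t.
apply: (@le_trans _ _ (x ^+ 2 * (expR (p ^+ 2 / (2 * q * eps)) * expR (q * l ^+ 2 * v)))).
rewrite ler_wpM2l ?sqr_ge0// -expRD ler_expR /v; lra.
rewrite mulrCA ler_wpM2l ?expR_ge0//.
have ev : expR (q * l ^+ 2 * v) <= 1 + expR v.
  have [v0|v0] := leP v 0.
    rewrite -[leLHS]addr0 lerD ?expR_ge0// expR_le1.
    by rewrite mulr_ge0_le0// mulr_ge0// ltW.
  rewrite -[leLHS]add0r lerD// ler_expR ler_piMl//; exact: ltW.
apply: (@le_trans _ _ (x ^+ 2 * (1 + expR v))); first by rewrite ler_wpM2l ?sqr_ge0.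
rewrite mulrDr mulr1 lerD2l.
have -> : eps * x ^+ 2 - t = v + eps * x ^+ 2 / 2 by rewrite /v; field.
have := expR_ge1Dx (eps * x ^+ 2 / 2); rewrite (expRD v); set e := expR (_ / 2) => he.
have -> : x ^+ 2 * expR v = expR v * (2 / eps * (eps * x ^+ 2 / 2)).
  by field; rewrite gt_eqF.
have -> : 2 / eps * (expR v * e) = expR v * (2 / eps * e) by ring.
rewrite ler_wpM2l ?expR_ge0// ler_wpM2l ?divr_ge0// ?ltW//; lra.
Qed.

End exp_expansion.

Section exponential_moments.
Context (R : realType) (d : measure_display) (T : measurableType d)
  (P : probability T R).

Lemma ae_ge0_integrable (f : T -> R) :
  measurable_fun setT f -> {ae P, forall w, 0 <= f w} ->
  (\int[P]_w (f w)%:E < +oo)%E -> P.-integrable setT (EFin \o f).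
Proof.
move=> mf f0 foo; apply/integrableP; split; first exact/measurable_EFinP.
rewrite (ae_eq_integral (EFin \o f))//.
- by apply/measurableT_comp => //; exact/measurable_EFinP.
- exact/measurable_EFinP.
- by apply: filterS f0 => w f0w _; rewrite /= ger0_norm.
Qed.

Variables tau X : {RV P >-> R}.
Hypotheses (tau_gt0 : {ae P, forall w, 0 < tau w})
  (exp_moment : exists2 eps : R, 0 < eps &
     ('E_P[fun w => expR (eps * X w ^+ 2 - tau w)] < +oo)%E)
  (mean_X : ('E_P[X] = 0)%E)
  (second_moment_X : ('E_P[fun w => (X w ^+ 2)%R] = 1)%E)
  (mean_tau : ('E_P[tau] = 1)%E).

Let tau_integrable : P.-integrable setT (EFin \o tau).
Proof.
apply: ae_ge0_integrable => //.
  by apply: filterS tau_gt0 => w /ltW.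
by move: mean_tau; rewrite unlock => ->; rewrite ltry.
Qed.

Let X2_integrable : P.-integrable setT (fun w => (X w ^+ 2)%:E).
Proof.
apply: ae_ge0_integrable => //.
- exact: measurable_funX.
- by apply: aeW => w; exact: sqr_ge0.
by move: second_moment_X; rewrite unlock => ->; rewrite ltry.
Qed.

Let X_integrable : P.-integrable setT (EFin \o X).
Proof.
have i1 : P.-integrable setT (fun w => (1 + X w ^+ 2)%:E).
  have := integrableD measurableT (finite_measure_integrable_cst P 1 measurableT) X2_integrable.
  by apply: eq_integrable => // w _ /=.
apply: le_integrable i1 => //; first exact/measurable_EFinP.
move=> w _ /=; rewrite lee_fin [leRHS]ger0_norm ?addr_ge0 ?sqr_ge0//.
rewrite -(real_normK (num_real (X w))).
have := sqr_ge0 (`|X w| - 1); rewrite sqrrB1; have := normr_ge0 (X w); lra.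
Qed.

Lemma quotient_bound_integrable (p q eps : R) : 0 < eps ->
  ('E_P[fun w => expR (eps * X w ^+ 2 - tau w)] < +oo)%E ->
  P.-integrable setT (fun w => (quotient_bound p q eps (X w) (tau w))%:E).
Proof.
move=> eps0; rewrite unlock => e_fin.
have iE : P.-integrable setT (fun w => (expR (eps * X w ^+ 2 - tau w))%:E).
  apply: ae_ge0_integrable => //.
  - apply: measurableT_comp => //; apply: measurable_funB => //.
    by apply: measurable_funM => //; exact: measurable_funX.
  - by apply: aeW => w; exact: expR_ge0.
rewrite /quotient_bound.
have Z (k : R) f : P.-integrable setT (fun w => (f w)%:E) ->
    P.-integrable setT (fun w => (k * f w)%:E).
  by move=> /(integrableZl measurableT k); apply: eq_integrable => // w _.
have D f g : P.-integrable setT (fun w => (f w)%:E) ->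
    P.-integrable setT (fun w => (g w)%:E) ->
    P.-integrable setT (fun w => (f w + g w)%:E).
  by move=> fi gi; have := integrableD measurableT fi gi; apply: eq_integrable => // w _.
apply: (D (fun w => _ + q * tau w)).
  apply: (D _ _); last exact: Z tau_integrable.
  by apply: (Z _ _); apply: (D _ _) => //; exact: Z.
under [X in integrable _ _ X]eq_fun do rewrite mulrC.
by apply: (Z _ _); apply: (D _ _); exact: Z.
Qed.

Let measurable_exponent (p q l : R) :
  measurable_fun setT (fun w => p * l * X w - q * l ^+ 2 * tau w).
Proof. by apply: measurable_funB; apply: measurable_funM. Qed.

Let measurable_quotient (p q l : R) :
  measurable_fun setT (fun w => exp_quotient p q (X w) (tau w) l).
Proof.
apply: measurable_funM => //; apply: measurable_funB.
  by apply: measurable_funB => //; apply: measurableT_comp.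
exact: measurable_funM.
Qed.

Let quotient_integrable (p q l : R) : 0 < q -> 0 < l -> q * l ^+ 2 <= 1 ->
  P.-integrable setT (fun w => (exp_quotient p q (X w) (tau w) l)%:E).
Proof.
move=> q0 l0 ql; have [eps eps0 e_fin] := exp_moment.
have /integrableP[mD Doo] := quotient_bound_integrable p q eps0 e_fin.
apply/integrableP; split; first exact/measurable_EFinP.
apply: le_lt_trans Doo; apply: ae_ge0_le_integral => //.
- by apply/measurableT_comp => //; exact/measurable_EFinP.
- exact: measurableT_comp.
apply: filterS tau_gt0 => w /ltW t0 _; rewrite /= lee_fin.
by apply: (le_trans _ (ler_norm _)); exact: exp_quotient_le.
Qed.

(** Dominated convergence is a statement about sequences: a failure of the
continuous limit yields a sequence of [l] tending to 0 that violates it. *)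
Lemma quotient_mean_cvg (p q kappa : R) : 0 < q -> 0 < kappa ->
  exists2 delta, 0 < delta & forall l, 0 < l < delta ->
  q * l ^+ 2 <= 1 /\
  exists2 r, (\int[P]_w (exp_quotient p q (X w) (tau w) l)%:E = r%:E)%E &
    `|r - (p ^+ 2 / 2 - q)| <= kappa.
Proof.
move=> q0 k0; have [eps eps0 e_fin] := exp_moment.
pose c := (q + 1)^-1.
have q10 : 0 < q + 1 by rewrite ltr_wpDl// ltW.
have c0 : 0 < c by rewrite invr_gt0.
have c1 : c <= 1 by rewrite invf_le1// lerDr ltW.
have small l : 0 < l < c -> l <= 1 /\ q * l ^+ 2 <= 1.
  move=> /andP[l0 lc]; have l1 : l <= 1 by rewrite (le_trans (ltW lc)).
  split => //; apply: (@le_trans _ _ (q * c)).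
    rewrite ler_wpM2l ?ltW// (le_lt_trans _ lc)// expr2 ler_piMl// ltW//.
  by rewrite ler_pdivrMr// mul1r lerDl.
apply: contrapT => H.
have {}H : forall n : nat, exists l, 0 < l < c * n.+1%:R^-1 /\
   (kappa < `|fine (\int[P]_w (exp_quotient p q (X w) (tau w) l)%:E)%E - (p ^+ 2 / 2 - q)|).
  move=> n; apply: contrapT => nl; apply: H.
  exists (c * n.+1%:R^-1); first by rewrite mulr_gt0.
  move=> l lcn; have lc : 0 < l < c.
    move/andP : lcn => [-> /=] /lt_le_trans; apply.
    by rewrite ler_piMr ?(ltW c0)// invf_le1// ler1n.
  have [_ ql] := small l lc; split => //.
  have lf := integrable_fin_num measurableT (quotient_integrable p q0 (andP lc).1 ql).
  exists (fine (\int[P]_w (exp_quotient p q (X w) (tau w) l)%:E)%E); first by rewrite fineK.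
  by rewrite leNgt; apply/negP => h; apply: nl; exists l.
have [u uP] := choice H.
have u0 n : 0 < u n by have [/andP[]] := uP n.
have uc n : u n < c * n.+1%:R^-1 by have [/andP[]] := uP n.
have uc' n : 0 < u n < c.
  by rewrite u0 (lt_le_trans (uc n))// ler_piMr ?(ltW c0)// invf_le1// ler1n.
have u_le n : u n <= c * n.+1%:R^-1 := ltW (uc n).
have u_cvg0 : u @ \oo --> 0.
  apply: (@squeeze_cvgr _ _ _ _ (fun=> 0) (fun n => c * n.+1%:R^-1)).
  - by apply: nearW => n; rewrite (ltW (u0 n)) u_le.
  - exact: cvg_cst.
  - by rewrite -(mulr0 c); apply: cvgMr => //; exact: cvg_harmonic.
have [|||||_ _ dct] := @dominated_convergence _ T R P setT measurableT
  (fun n w => (exp_quotient p q (X w) (tau w) (u n))%:E)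
  (fun w => (p ^+ 2 * X w ^+ 2 / 2 - q * tau w)%:E)
  (fun w => (quotient_bound p q eps (X w) (tau w))%:E).
- by move=> n; exact/measurable_EFinP.
- apply/measurable_EFinP; apply: measurable_funB; apply: measurable_funM => //.
  by apply: measurable_funM => //; exact: measurable_funX.
- apply: aeW => w _; apply/fine_cvgP; split; first exact: nearW.
  have [C HC] := exp_quotient_cvg p q (X w) (tau w).
  apply/subr_cvg0.
  apply/norm_cvg0P.
  apply: (@squeeze_cvgr _ _ _ _ (fun=> 0) (fun n => C * u n)).
  + apply: nearW => n /=; rewrite normr_ge0 distrC -normrN opprB.
    by apply: HC; rewrite u0 (small _ (uc' n)).1.
  + exact: cvg_cst.
  + by rewrite -(mulr0 C); apply: cvgMr.
- exact: quotient_bound_integrable.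
- apply: filterS tau_gt0 => w /ltW t0 n _; rewrite lee_fin.
  by apply: exp_quotient_le => //; exact: (small _ (uc' n)).2.
have lim_integral : (\int[P]_w (p ^+ 2 * X w ^+ 2 / 2 - q * tau w)%:E =
    (p ^+ 2 / 2 - q)%:E)%E.
  have iX : P.-integrable setT (fun w => (p ^+ 2 / 2)%:E * (X w ^+ 2)%:E)%E.
    exact: integrableZl.
  have it : P.-integrable setT (fun w => q%:E * (tau w)%:E)%E by exact: integrableZl.
  under eq_integral do rewrite EFinB mulrAC EFinM [in X in (_ - X)%E]EFinM.
  rewrite integralB//= integralZl// integralZl//.
  move: second_moment_X mean_tau; rewrite unlock => -> ->.
  by rewrite !mule1.
move: dct; rewrite lim_integral => /fine_cvgP[_ /cvgrPdist_le /(_ _ k0)[N _ HN]].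
have [_] := uP N; rewrite distrC ltNge => /negP; apply.
exact: (HN N (leqnn N)).
Qed.

(** This is [ln u <= u - 1] at the inverse of [1 + y]. *)
Lemma ln1Dx_ge (y : R) : 0 < 1 + y -> y / (1 + y) <= ln (1 + y).
Proof.
move=> y0; have := @le_ln1Dx _ (- (y / (1 + y))).
have -> : 1 + - (y / (1 + y)) = (1 + y)^-1 by field; rewrite gt_eqF.
rewrite lnV ?posrE// lerN2; apply.
rewrite ltrNl opprK ltr_pdivrMr//; lra.
Qed.

(** The expectation is [1 + l^2 r] with [r] close to [p^2 / 2 - q], the mean of
the limit quotient. In exponential form it can be cancelled exactly by the rate
[g] of a tilt. *)
Lemma exp_moment_asymptotics (p q kappa : R) : 0 < q -> 0 < kappa ->
  exists2 delta, 0 < delta & forall l, 0 < l < delta ->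
  exists2 z, (\int[P]_w (expR (p * l * X w - q * l ^+ 2 * tau w))%:E =
              (expR (l ^+ 2 * z))%:E)%E &
    `|z - (p ^+ 2 / 2 - q)| <= kappa.
Proof.
move=> q0 k0; pose L := p ^+ 2 / 2 - q; pose B := `|L| + kappa.
have B0 : 0 < B by rewrite ltr_wpDl.
have k20 : 0 < kappa / 2 by rewrite divr_gt0.
have [delta delta0 Hdelta] := quotient_mean_cvg p q0 k20.
pose c := Num.min (1 / (2 * B)) (kappa / (4 * B ^+ 2)).
have c0 : 0 < c by rewrite lt_min !divr_gt0// mulr_gt0// exprn_gt0.
exists (Num.min delta (Num.min 1 c)); first by rewrite lt_min delta0 lt_min ltr01.
move=> l /andP[l0]; rewrite lt_min => /andP[ld]; rewrite lt_min => /andP[l1 lc].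
have [|ql [r Er rL]] := Hdelta l; first by rewrite l0.
have l20 : 0 < l ^+ 2 by rewrite exprn_gt0.
have l2c : l ^+ 2 <= c by rewrite (le_trans _ (ltW lc))// expr2 ler_piMl// ltW.
have l2B : l ^+ 2 * B <= 1 / 2.
  have : l ^+ 2 <= 1 / (2 * B) by rewrite (le_trans l2c)// ge_min lexx.
  rewrite ler_pdivlMr ?mulr_gt0//; lra.
have l2k : 4 * (l ^+ 2 * B ^+ 2) <= kappa.
  have : l ^+ 2 <= kappa / (4 * B ^+ 2) by rewrite (le_trans l2c)// ge_min lexx orbT.
  rewrite ler_pdivlMr ?mulr_gt0 ?exprn_gt0//; lra.
have rB : `|r| <= B.
  by rewrite -(subrK L r) (le_trans (ler_normD _ _))// /B addrC lerD2l (le_trans rL)//; lra.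
have y12 : `|l ^+ 2 * r| <= 1 / 2.
  by rewrite normrM (ger0_norm (ltW l20)) (le_trans _ l2B)// ler_wpM2l// ltW.
have y0 : 1 / 2 <= 1 + l ^+ 2 * r by move: y12; rewrite ler_norml; lra.
have y00 : 0 < 1 + l ^+ 2 * r by lra.
exists (ln (1 + l ^+ 2 * r) / l ^+ 2).
  rewrite [X in expR X]mulrC divfK ?gt_eqF// lnK ?posrE//.
  have iq : P.-integrable setT (fun w => (l ^+ 2)%:E * (exp_quotient p q (X w) (tau w) l)%:E)%E.
    by apply: integrableZl => //; exact: quotient_integrable.
  have iX : P.-integrable setT (fun w => (p * l)%:E * (X w)%:E)%E by exact: integrableZl.
  have i1 := finite_measure_integrable_cst P 1 measurableT.
  under eq_integral => w _.
    rewrite [X in X%:E](_ : _ = (1 + p * l * X w) + l ^+ 2 * exp_quotient p q (X w) (tau w) l); last first.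
      by rewrite /exp_quotient; field; rewrite gt_eqF.
    rewrite EFinD EFinD !EFinM; over.
  have i2 := integrableD measurableT i1 iX.
  rewrite integralD//= integralD//= !integralZl//=; last exact: quotient_integrable.
  move: mean_X; rewrite unlock => ->.
  by rewrite Er integral_cst// mul1e mule0 adde0 [X in (X + _)%E]probability_setT -EFinM -EFinD.
have zr : ln (1 + l ^+ 2 * r) / l ^+ 2 <= r.
  by rewrite ler_pdivrMr// [leRHS]mulrC le_ln1Dx//; lra.
have rz : r - kappa / 2 <= ln (1 + l ^+ 2 * r) / l ^+ 2.
  rewrite ler_pdivlMr//; apply: le_trans (ln1Dx_ge y00).
  rewrite ler_pdivlMr//.
  have r2 : r ^+ 2 <= B ^+ 2 by rewrite -(real_normK (num_real r)) lerXn2r// nnegrE// ltW.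
  suff : 0 <= l ^+ 2 * (kappa / 2 * (1 + l ^+ 2 * r) - l ^+ 2 * r ^+ 2) by lra.
  rewrite mulr_ge0 ?(ltW l20)// subr_ge0.
  apply: (@le_trans _ _ (kappa / 2 * (1 / 2))); last by rewrite ler_wpM2l// ltW.
  have : l ^+ 2 * r ^+ 2 <= l ^+ 2 * B ^+ 2 by rewrite ler_wpM2l// ltW.
  lra.
move: rL; rewrite !ler_norml; lra.
Qed.

End exponential_moments.

(** * Paths on which no comparison product crosses *)

Section good_paths.
Variable R : realType.
Implicit Types eta p q g l t z x T m n k : R.

Definition tilt_exponent l p q g x T n : R :=
  p * l * x - q * l ^+ 2 * T - g * l ^+ 2 * n.

(** The rate needed for the power [1 + eta] of a tilt with [q = p^2 / 2] to be a
supermartingale: [((1 + eta) p)^2 / 2 - (1 + eta) q] plus a margin. *)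
Definition power_rate eta q : R := eta * (1 + eta) * q + eta ^+ 2.

(** Each comparison product has its rate [g] above the asymptotic value
[p^2 / 2 - q] by a margin of order at least [eta^2], which absorbs the errors
[kappa] of the expansion. *)
Lemma tilt_slack eta p q (z0 z1 z2 z3 z4 : R) :
  let kappa := eta ^+ 2 / 8 in
  0 < eta -> 12 * eta <= 1 -> q = p ^+ 2 / 2 ->
  `|z0 - (p ^+ 2 / 2 - q)| <= kappa ->
  `|z1 - (p ^+ 2 / 2 - (q + 1))| <= kappa ->
  `|z2 - (p ^+ 2 / 2 - (q - 4^-1))| <= kappa ->
  `|z3 - ((p - eta) ^+ 2 / 2 - q)| <= kappa ->
  `|z4 - (((1 + eta) * p) ^+ 2 / 2 - (1 + eta) * q)| <= kappa ->
  [/\ z1 <= z0 - (1 - eta / 4), z2 <= z0 + 4^-1 * (1 + eta / 2),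
      z3 <= z0 - (p * eta - eta ^+ 2) & z4 <= (1 + eta) * z0 + power_rate eta q].
Proof.
move=> kappa eta_gt0 eta_le qE; rewrite !ler_norml /kappa.
have e2 : eta ^+ 2 <= eta / 12 by nra.
have pE : p ^+ 2 = 2 * q by rewrite qE; field.
move=> /andP[a0 b0] /andP[a1 b1] /andP[a2 b2] /andP[a3 b3] /andP[a4 b4].
split; [lra|lra|lra|].
have : eta * - (eta ^+ 2 / 8) <= eta * z0 by rewrite ler_pM2l//; lra.
have : eta * eta ^+ 2 <= eta ^+ 2 by rewrite ler_piMl ?sqr_ge0//; lra.
move: b4; rewrite /power_rate exprMn pE; lra.
Qed.

(** The next four lemmas read off the path properties from the failure of a
crossing at level [eta^2 l^2 t / 2]. In each of them the common terms of the two
exponents cancel; what is left is linear in the time, in the reward, or in the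
exponent of the weight itself. *)
Lemma good_time_gt eta p q l t z x T n :
  0 < eta -> 12 * eta <= 1 -> 0 < l -> 0 < t -> (1 + eta) * t <= n ->
  tilt_exponent l p (q + 1) (z - (1 - eta / 4)) x T n <
    eta ^+ 2 * (l ^+ 2 * t) / 2 + tilt_exponent l p q z x T n ->
  t < T.
Proof.
rewrite /tilt_exponent => eta_gt0 eta_le l_gt0 t_gt0 nt h.
have l2_gt0 : 0 < l ^+ 2 by rewrite exprn_gt0.
have {}h : (1 - eta / 4) * n - eta ^+ 2 * t / 2 < T.
  by rewrite -(ltr_pM2l l2_gt0); lra.
have h1 : 0 <= (1 - eta / 4) * (n - (1 + eta) * t).
  by rewrite mulr_ge0 ?subr_ge0//; lra.
have h2 : 0 <= eta * t * (1 - eta).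
  by rewrite mulr_ge0 ?(mulr_ge0 (ltW eta_gt0) (ltW t_gt0))//; lra.
lra.
Qed.

Lemma good_time_le eta p q l t z x T m :
  0 < eta -> 12 * eta <= 1 -> 0 < l -> 0 < t -> m <= (1 - eta) * t ->
  tilt_exponent l p (q - 4^-1) (z + 4^-1 * (1 + eta / 2)) x T m <
    eta ^+ 2 * (l ^+ 2 * t) / 2 + tilt_exponent l p q z x T m ->
  T <= t.
Proof.
rewrite /tilt_exponent => eta_gt0 eta_le l_gt0 t_gt0 mt h.
have l2_gt0 : 0 < l ^+ 2 by rewrite exprn_gt0.
have {}h : T < (1 + eta / 2) * m + 2 * eta ^+ 2 * t.
  by rewrite -(ltr_pM2l l2_gt0); lra.
have h1 : 0 <= (1 + eta / 2) * ((1 - eta) * t - m).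
  by rewrite mulr_ge0 ?subr_ge0//; lra.
have h2 : 0 <= eta * t * (1 - 3 * eta).
  by rewrite mulr_ge0 ?(mulr_ge0 (ltW eta_gt0) (ltW t_gt0))//; lra.
lra.
Qed.

Lemma good_reward_gt eta p q l t z x T k :
  0 < eta -> 12 * eta <= 1 -> 0 < l -> 0 < t -> p = 1 + 4 * eta ->
  (1 - 2 * eta) * t <= k ->
  tilt_exponent l (p - eta) q (z - (p * eta - eta ^+ 2)) x T k <
    eta ^+ 2 * (l ^+ 2 * t) / 2 + tilt_exponent l p q z x T k ->
  l * t < x.
Proof.
rewrite /tilt_exponent => eta_gt0 eta_le l_gt0 t_gt0 pE kt h.
have leta0 : 0 < l * eta by rewrite mulr_gt0.
have {}h : l * ((p - eta) * k - eta * t / 2) < x.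
  by rewrite -(ltr_pM2l leta0); lra.
apply: le_lt_trans h; rewrite ler_pM2l//.
have h1 : 0 <= (1 + 3 * eta) * (k - (1 - 2 * eta) * t).
  by rewrite mulr_ge0 ?subr_ge0//; lra.
have h2 : 0 <= eta * t * (1 - 12 * eta).
  by rewrite mulr_ge0 ?(mulr_ge0 (ltW eta_gt0) (ltW t_gt0))//; lra.
rewrite pE; lra.
Qed.

Lemma good_weight_le eta p q l t z x T n :
  0 < eta -> 12 * eta <= 1 -> 0 < l -> 0 < t -> q = (1 + 4 * eta) ^+ 2 / 2 ->
  n <= (1 + 2 * eta) * t ->
  tilt_exponent l ((1 + eta) * p) ((1 + eta) * q)
      ((1 + eta) * z + power_rate eta q) x T n <
    eta ^+ 2 * (l ^+ 2 * t) / 2 + tilt_exponent l p q z x T n ->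
  tilt_exponent l p q z x T n <= (2^-1 + 11 * eta) * (l ^+ 2 * t).
Proof.
move=> eta_gt0 eta_le l_gt0 t_gt0 qE nt h.
have l2_gt0 : 0 < l ^+ 2 by rewrite exprn_gt0.
rewrite -(ler_pM2l eta_gt0).
set r := power_rate eta q in h.
have {}h : eta * tilt_exponent l p q z x T n <= l ^+ 2 * (r * n + eta ^+ 2 * t / 2).
  by move: h; rewrite /tilt_exponent; lra.
apply: (le_trans h).
have -> : eta * ((2^-1 + 11 * eta) * (l ^+ 2 * t)) =
  l ^+ 2 * (eta * (2^-1 + 11 * eta) * t) by ring.
rewrite ler_pM2l//.
have r_ge0 : 0 <= r.
  rewrite /r /power_rate qE; apply: addr_ge0; last exact: sqr_ge0.
  apply: mulr_ge0; last by rewrite divr_ge0// sqr_ge0.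
  by rewrite mulr_ge0 ?(ltW eta_gt0)//; lra.
have h1 : 0 <= r * ((1 + 2 * eta) * t - n) by rewrite mulr_ge0// subr_ge0.
suff h2 : r * (1 + 2 * eta) + eta ^+ 2 / 2 <= eta * (2^-1 + 11 * eta).
  have : 0 <= (eta * (2^-1 + 11 * eta) - (r * (1 + 2 * eta) + eta ^+ 2 / 2)) * t.
    by rewrite mulr_ge0 ?subr_ge0// ltW.
  lra.
have h3 : 0 <= eta ^+ 2 * (1 - 12 * eta) by rewrite mulr_ge0 ?sqr_ge0//; lra.
have h4 : 0 <= eta ^+ 3 * (1 - 12 * eta).
  by rewrite mulr_ge0 ?(exprn_ge0 _ (ltW eta_gt0))//; lra.
have h5 : 0 <= eta ^+ 4 * (1 - 12 * eta).
  by rewrite mulr_ge0 ?(exprn_ge0 _ (ltW eta_gt0))//; lra.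
have h6 : 0 <= eta ^+ 2 by exact: sqr_ge0.
rewrite /r /power_rate qE; lra.
Qed.

Lemma time_large eta delta l t :
  0 < eta -> 12 * eta <= 1 -> 0 < delta -> delta <= eta / 4 -> 0 < l < delta ->
  delta^-1 ^+ 2 < l ^+ 2 * t ->
  16 < eta ^+ 2 * (l ^+ 2 * t) /\ 1 <= eta * t.
Proof.
move=> eta_gt0 eta_le delta_gt0 delta_le /andP[l_gt0 l_lt] lt_large.
have eta_x : 16 < eta ^+ 2 * (l ^+ 2 * t).
  have h : (4 / eta) ^+ 2 < l ^+ 2 * t.
    apply: le_lt_trans lt_large; rewrite lerXn2r ?nnegrE ?invr_ge0 ?divr_ge0
      ?(ltW delta_gt0) ?(ltW eta_gt0)//.
    by rewrite -[4 / eta]invf_div lef_pV2 ?posrE// divr_gt0.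
  have -> : 16 = eta ^+ 2 * (4 / eta) ^+ 2 :> R by field; rewrite gt_eqF.
  by rewrite ltr_pM2l// exprn_gt0.
split=> //.
have l1 : l ^+ 2 <= 1 by rewrite expr_le1 ?(ltW l_gt0)//; lra.
have l2_gt0 : 0 < l ^+ 2 by rewrite exprn_gt0.
have t_gt0 : 0 < t.
  rewrite -(pmulr_rgt0 _ l2_gt0); apply: le_lt_trans lt_large; exact: sqr_ge0.
have h1 : eta * (1 - l ^+ 2) * (eta * t) >= 0.
  by rewrite !mulr_ge0 ?subr_ge0 ?(ltW eta_gt0) ?(ltW t_gt0).
have h2 : (1 - eta) * (eta * t) >= 0.
  by rewrite !mulr_ge0 ?subr_ge0 ?(ltW eta_gt0) ?(ltW t_gt0)//; lra.
lra.
Qed.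

Lemma renewal_counts eta t : 0 < eta -> 12 * eta <= 1 -> 1 <= eta * t -> 0 < t ->
  exists m n : nat, [/\ (m <= n)%N,
    (1 - 2 * eta) * t <= m%:R, m%:R <= (1 - eta) * t,
    (1 + eta) * t <= n%:R & n%:R <= (1 + 2 * eta) * t].
Proof.
move=> eta_gt0 eta_le eta_t t_gt0.
have c1 : 0 <= (1 - eta) * t by rewrite mulr_ge0 ?(ltW t_gt0)//; lra.
have c2 : 0 <= (1 + eta) * t by rewrite mulr_ge0 ?(ltW t_gt0)//; lra.
exists (Num.truncn ((1 - eta) * t)), (Num.truncn ((1 + eta) * t)).+1.
have /andP[] := truncn_itv c1; have /andP[] := truncn_itv c2.
rewrite -(ler_nat R) -!(@natr1 R (Num.truncn _)).
set u := (Num.truncn _)%:R; set v := (Num.truncn _)%:R.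
by move=> ? ? ? ?; split; lra.
Qed.

Lemma expR_half_le eta eps y : 12 * eta <= eps -> 0 <= y -> 1 <= eta * y ->
  expR (- (2^-1 + eps) * y) <= expR (- ((2^-1 + 11 * eta) * y)) / 2.
Proof.
move=> eta_eps y0 ey; rewrite ler_pdivlMr//.
have e2 : 2 <= expR (eta * y) by apply: le_trans (expR_ge1Dx _); lra.
apply: (@le_trans _ _ (expR (- (2^-1 + eps) * y) * expR (eta * y))).
  by rewrite ler_wpM2l ?expR_ge0.
rewrite -expRD ler_expR.
have : 0 <= (eps - 12 * eta) * y by rewrite mulr_ge0// subr_ge0.
lra.
Qed.

End good_paths.

(** * Tail bounds for the renewal-reward process *)

(** Applied to the renewal times, this produces the number of renewals before a
given time, from two counts that bracket it. *)
Lemma discrete_ivt (R : realDomainType) (f : nat -> R) (t : R) m n :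
  f m <= t -> (m <= n)%N -> t < f n ->
  exists k, [/\ (m <= k)%N, (k < n)%N, f k <= t & t < f k.+1].
Proof.
move=> fm; elim: n => [|n IHn].
  by rewrite leqn0 => /eqP <-; rewrite ltNge fm.
rewrite leq_eqVlt => /orP[/eqP <-|mn]; first by rewrite ltNge fm.
have [tfn _|fnt tfn] := ltP t (f n).
  by have [k [mk kn fk fk1]] := IHn mn tfn; exists k; split => //; exact: ltnW.
by exists n; split.
Qed.

Section renewal_reward.
Context (R : realType)
    (d0 : measure_display) (T0 : measurableType d0) (P0 : probability T0 R)
    (tau0 X0 : {RV P0 >-> R})
    (d : measure_display) (T : measurableType d) (P : probability T R)
    (tau X : nat -> {RV P >-> R}) (S : R -> {RV P >-> R}).
Hypotheses (tau0_gt0 : {ae P0, forall w, 0 < tau0 w})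
    (copies : independent_copies P0 P (fun w => (tau0 w, X0 w))
                (fun i w => (tau i w, X i w)))
    (S_process : renewal_reward_process P tau X S)
    (exp_moment : exists2 eps : R, 0 < eps &
       ('E_P0[fun w => expR (eps * X0 w ^+ 2 - tau0 w)] < +oo)%E)
    (mean_X : ('E_P0[X0] = 0)%E)
    (second_moment_X : ('E_P0[fun w => (X0 w ^+ 2)%R] = 1)%E)
    (mean_tau : ('E_P0[tau0] = 1)%E).

Let Y i w := (tau i w, X i w).

Let mY i : measurable_fun setT (Y i).
Proof. by apply/measurable_fun_pairP; split. Qed.

Let indepY : mutually_independent P Y := copies.1.

Lemma expectation_copy (f : R * R -> R) i :
  measurable_fun setT f -> (forall y, 0 <= f y) ->
  (\int[P]_w (f (Y i w))%:E = \int[P0]_w (f (tau0 w, X0 w))%:E)%E.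
Proof.
move=> mf f0.
have mY0 : measurable_fun setT (fun w => (tau0 w, X0 w)).
  by apply/measurable_fun_pairP; split.
pose Yi : {mfun T >-> (R * R)%type} := HB.pack (Y i)
  (isMeasurableFun.Build _ _ _ _ _ (mY i)).
pose Y0 : {mfun T0 >-> (R * R)%type} := HB.pack (fun w => (tau0 w, X0 w))
  (isMeasurableFun.Build _ _ _ _ _ mY0).
have mef : measurable_fun setT (EFin \o f) by exact/measurable_EFinP.
have ef0 y : (0 <= (EFin \o f) y)%E by rewrite lee_fin.
have := ge0_integral_distribution (P := P) Yi mef ef0.
have := ge0_integral_distribution (P := P0) Y0 mef ef0.
move=> /= <- <-; apply: eq_measure_integral => A mA _.
exact: copies.2.
Qed.

(** The scaling makes [p], [q] and [g] of order 1 when [l] is small. A point of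
[R * R] is a waiting time followed by a reward. *)
Definition tilt (l p q g : R) (y : R * R) : R :=
  expR (tilt_exponent l p q g y.2 y.1 1).

Definition log_weight (l p q g : R) (n : nat) (w : T) : R :=
  tilt_exponent l p q g (\sum_(i < n) X i w) (\sum_(i < n) tau i w) n%:R.

Lemma weight_tilt l p q g n w :
  weight Y (tilt l p q g) n w = expR (log_weight l p q g n w).
Proof.
rewrite /weight /tilt -expR_sum; congr expR; rewrite /log_weight /tilt_exponent.
by rewrite !sumrB sumr_const card_ord -[X in _ - X]mulr_natr -!mulr_sumr mulr1.
Qed.

Lemma tilt_ge0 l p q g y : 0 <= tilt l p q g y.
Proof. exact: expR_ge0. Qed.

Lemma measurable_tilt l p q g : measurable_fun setT (tilt l p q g).
Proof.
apply: measurableT_comp => //; apply: measurable_funB => //.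
by apply: measurable_funB; apply: measurable_funM.
Qed.

Lemma expectation_tilt (p q kappa : R) : 0 < q -> 0 < kappa ->
  exists2 delta, 0 < delta & forall l, 0 < l < delta ->
  exists2 z, forall i g, (\int[P]_w (tilt l p q g (Y i w))%:E =
              (expR (l ^+ 2 * (z - g)))%:E)%E &
    `|z - (p ^+ 2 / 2 - q)| <= kappa.
Proof.
move=> q0 k0.
have [delta delta0 H] := exp_moment_asymptotics tau0_gt0 exp_moment mean_X
  second_moment_X mean_tau p q0 k0.
exists delta => // l /H[z Ez zk]; exists z => // i g.
rewrite expectation_copy; [|exact: measurable_tilt|exact: tilt_ge0].
under eq_integral => w _ do rewrite /tilt /tilt_exponent mulr1 expRD EFinM.
rewrite ge0_integralZr//.
- by rewrite Ez -EFinM -expRD; congr (expR _)%:E; ring.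
- apply/measurable_EFinP/measurableT_comp => //.
  by apply: measurable_funB; apply: measurable_funM.
Qed.

Definition tilt_crossed l p q g p' q' g' s n w :=
  crossed Y (tilt l p q g) (tilt l p' q' g') (expR s) n w.

Lemma tilt_crossedP l p q g p' q' g' s n w : reflect
  (exists2 k, (k <= n)%N & s + log_weight l p q g k w <= log_weight l p' q' g' k w)
  (tilt_crossed l p q g p' q' g' s n w).
Proof.
apply: (iffP (crossedP _ _ _ _ _ _)) => -[k kn].
  by rewrite !weight_tilt -expRD ler_expR => h; exists k.
by move=> h; exists k => //; rewrite !weight_tilt -expRD ler_expR.
Qed.

Lemma tilted_maximal_inequality l p q g p' q' g' s n :
  (forall i, \int[P]_w (tilt l p q g (Y i w))%:E = 1)%E ->
  (forall i, \int[P]_w (tilt l p' q' g' (Y i w))%:E <= 1)%E ->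
  (\int[P]_w (if tilt_crossed l p q g p' q' g' s n w
              then expR (log_weight l p q g n w) else 0)%:E <= (expR (- s))%:E)%E.
Proof.
move=> E1 E2.
have := weighted_maximal_inequality mY indepY n (measurable_tilt l p q g) (@tilt_ge0 l p q g)
  (measurable_tilt l p' q' g') (@tilt_ge0 l p' q' g') E1 E2 (expR_gt0 s).
by rewrite -expRN; under eq_integral do rewrite weight_tilt.
Qed.

Lemma measurable_tilt_crossed l p q g p' q' g' s n :
  measurable_fun setT (tilt_crossed l p q g p' q' g' s n).
Proof. by apply: crossed_measurable => //; exact: measurable_tilt. Qed.

Lemma measurable_log_weight l p q g n :
  measurable_fun setT (log_weight l p q g n).
Proof.
apply: measurable_funB => //.
by apply: measurable_funB; apply: measurable_funM => //; exact: measurable_sum.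
Qed.

Let measurable_event (b : T -> bool) :
  measurable_fun setT b -> measurable [set w | b w].
Proof.
by move=> mb; rewrite -[X in measurable X]setTI; exact: (mb measurableT [set true]).
Qed.

Let measurable_exceeds t r : measurable [set w | r < S t w].
Proof. by apply: measurable_event; exact: measurable_fun_ltr. Qed.

Lemma renewal_value_between t m n w : (m <= n)%N ->
  (forall k, \sum_(i < k) tau i w <= t < \sum_(i < k.+1) tau i w ->
    S t w = \sum_(i < k) X i w) ->
  \sum_(i < m) tau i w <= t < \sum_(i < n) tau i w ->
  exists k, [/\ (m <= k <= n)%N, \sum_(i < k) tau i w <= t &
    S t w = \sum_(i < k) X i w].
Proof.
move=> mn Sw /andP[tm tn].
have [k [mk kn tk tk1]] := discrete_ivt (f := fun k => \sum_(i < k) tau i w) tm mn tn.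
exists k; split => //; first by rewrite mk (ltnW kn).
by apply: Sw; rewrite tk tk1.
Qed.

Let tilt0 l i : (\int[P]_w (tilt l 0 0 0 (Y i w))%:E = 1)%E.
Proof.
under eq_integral => w _ do rewrite /tilt /tilt_exponent !mul0r !subr0 expR0.
by rewrite integral_cst// mul1e; exact: probability_setT.
Qed.

(** The tilt with all parameters 0 is identically 1, so that the weighted law is
[P] itself. *)
Lemma tilt_crossed_probability l p q g s n :
  (forall i, \int[P]_w (tilt l p q g (Y i w))%:E <= 1)%E ->
  (P [set w | tilt_crossed l 0 0 0 p q g s n w] <= (expR (- s))%:E)%E.
Proof.
move=> E1; apply: le_trans (tilted_maximal_inequality s n (tilt0 l) E1).
have mc := @measurable_tilt_crossed l 0 0 0 p q g s n.
have mE := measurable_event mc.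
rewrite -(setIT [set w | _]) -integral_indic//.
rewrite le_eqVlt; apply/orP; left; apply/eqP; apply: eq_integral => w _.
rewrite indicE /log_weight /tilt_exponent !mul0r !subr0 expR0.
case: ifPn => h; first by rewrite mem_set.
by rewrite memNset//; exact/negP.
Qed.

(** The number of renewals before [t] is random and unbounded, but the maximal
inequality over [k <= n] controls all its values below [n] at once, with a bound
free of [n]; the event that there are [n] renewals before [t] disappears as [n]
grows, by the case [p = 0]. *)
Lemma upper_tail_bound (eps : R) : 0 < eps ->
  exists2 delta, 0 < delta & forall l t : R, 0 < l < delta -> 0 < t ->
  (P [set w | (l * t < S t w)%R] <= (expR (- (2^-1 - eps) * (l ^+ 2 * t)))%:E)%E.
Proof.
move=> eps0.
have q0 : 0 < 2^-1 + eps by rewrite addr_gt0.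
have h0 : 0 < 2^-1 :> R by [].
have [d1 d10 H1] := expectation_tilt 1 q0 eps0.
have [d2 d20 H2] := expectation_tilt 0 ltr01 h0.
exists (Num.min d1 d2); first by rewrite lt_min d10.
move=> l t /andP[l0]; rewrite lt_min => /andP[l1 l2] t0.
have l20 : 0 < l ^+ 2 by rewrite exprn_gt0.
have [|z1 Ez1 z1k] := H1 l; first by rewrite l0.
have [|z2 Ez2 z2k] := H2 l; first by rewrite l0.
have M1 i : (\int[P]_w (tilt l 1 (2^-1 + eps) 0 (Y i w))%:E <= 1)%E.
  rewrite Ez1 lee_fin expR_le1 subr0 mulr_ge0_le0 ?(ltW l20)//.
  by move: z1k; rewrite ler_norml; lra.
have M2 i : (\int[P]_w (tilt l 0 1 (- 2^-1) (Y i w))%:E <= 1)%E.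
  rewrite Ez2 lee_fin expR_le1 mulr_ge0_le0 ?(ltW l20)//.
  by move: z2k; rewrite ler_norml; lra.
pose s1 := (2^-1 - eps) * (l ^+ 2 * t).
have [N [mN PN0 subN]] := S_process.
have main n : (P [set w | (l * t < S t w)%R] <=
    (expR (- s1))%:E + (expR (- (l ^+ 2 * (n%:R / 2 - t))))%:E)%E.
  pose C1 := [set w | tilt_crossed l 0 0 0 1 (2^-1 + eps) 0 s1 n w].
  pose C2 := [set w | tilt_crossed l 0 0 0 0 1 (- 2^-1) (l ^+ 2 * (n%:R / 2 - t)) n w].
  have mC1 : measurable C1 by apply: measurable_event; exact: measurable_tilt_crossed.
  have mC2 : measurable C2 by apply: measurable_event; exact: measurable_tilt_crossed.
  apply: (@le_trans _ _ (P ((C1 `|` C2) `|` N))).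
    apply: le_measure; rewrite ?inE//; first by apply: measurableU => //; exact: measurableU.
    move=> w /= Sw; have [Nw|nNw] := pselect (N w); [by right|left].
    have {nNw}Sproc : forall k, \sum_(i < k) tau i w <= t < \sum_(i < k.+1) tau i w ->
        S t w = \sum_(i < k) X i w.
      have := contra_notP (subN w) nNw; move=> H k; apply: H; exact: ltW.
    have [tn|nt] := leP (\sum_(i < n) tau i w) t.
      right; apply/tilt_crossedP; exists n => //.
      have : 0 <= l ^+ 2 * (t - \sum_(i < n) tau i w) by rewrite mulr_ge0 ?(ltW l20)// subr_ge0.
      rewrite /log_weight /tilt_exponent; lra.
    left; have [|k [/andP[_ kn] Tk Sk]] := renewal_value_between (leq0n n) Sproc.
      by rewrite big_ord0 (ltW t0).
    apply/tilt_crossedP; exists k => //.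
    have : 0 <= l ^+ 2 * (t - \sum_(i < k) tau i w) by rewrite mulr_ge0 ?(ltW l20)// subr_ge0.
    have : 0 <= l * (S t w - l * t) by rewrite mulr_ge0 ?(ltW l0)// subr_ge0 ltW.
    rewrite /log_weight /tilt_exponent /s1 -Sk.
    have : 0 <= eps * (l ^+ 2 * (t - \sum_(i < k) tau i w)).
      by rewrite mulr_ge0 ?(ltW eps0)// mulr_ge0 ?(ltW l20)// subr_ge0.
    lra.
  apply: (le_trans (measureU2 _ _ _)) => //; first exact: measurableU.
  rewrite [X in (_ + X <= _)%E]PN0 adde0; apply: (le_trans (measureU2 _ _ _)) => //.
  by apply: leeD; exact: tilt_crossed_probability.
(* choose [n] so large that the second term is below [e] *)
apply/lee_addgt0Pr => e e0.
pose n := (Num.truncn (2 * (t + 1 / (e * l ^+ 2)))).+1.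
rewrite mulNr -/s1; apply: le_trans (main n) _; rewrite leeD2l// lee_fin.
have h : e^-1 <= l ^+ 2 * (n%:R / 2 - t).
  have : 2 * (t + 1 / (e * l ^+ 2)) < n%:R by exact: truncnS_gt.
  have -> : e^-1 = l ^+ 2 * (1 / (e * l ^+ 2)) by field; rewrite !gt_eqF.
  by move=> h; rewrite ler_wpM2l ?(ltW l20)//; lra.
rewrite expRN -[leRHS]invrK lef_pV2 ?posrE ?expR_gt0 ?invr_gt0//.
by apply: (le_trans h); apply: le_trans (expR_ge1Dx _); lra.
Qed.

Let uncrossed_lt l p q g p' q' g' s n w k : (k <= n)%N ->
  ~~ tilt_crossed l p q g p' q' g' s n w ->
  log_weight l p' q' g' k w < s + log_weight l p q g k w.
Proof.
move=> kn; apply: contraNT; rewrite -leNgt => h.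
by apply/tilt_crossedP; exists k.
Qed.

(** Change of measure: under the law of density [exp (log_weight l p q g n)],
every tilt of [L] stays below [exp s] times the weight, except on a set of mass
at most 1/2. On the rest, of mass at least 1/2, the density is at most [exp K]. *)
Lemma tilted_lower_bound l p q g s K n (L : seq (R * R * R)) (A : set T) :
  (forall i, \int[P]_w (tilt l p q g (Y i w))%:E = 1)%E ->
  {in L, forall c, forall i,
    \int[P]_w (tilt l c.1.1 c.1.2 c.2 (Y i w))%:E <= 1}%E ->
  (size L)%:R * expR (- s) <= 2^-1 -> measurable A ->
  {ae P, forall w,
    {in L, forall c, forall k, (k <= n)%N ->
      log_weight l c.1.1 c.1.2 c.2 k w < s + log_weight l p q g k w} ->
    A w /\ log_weight l p q g n w <= K} ->
  ((expR (- K) / 2)%:E <= P A)%E.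
Proof.
move=> E1 EL Ls mA [N [mN PN0 subN]].
pose W w := expR (log_weight l p q g n w).
have mW : measurable_fun setT W.
  by apply: measurableT_comp => //; exact: measurable_log_weight.
have W1 : (\int[P]_w (W w)%:E = 1)%E.
  rewrite -(expectation_weight mY indepY n (measurable_tilt l p q g) (@tilt_ge0 l p q g) E1).
  by apply: eq_integral => w _; rewrite weight_tilt.
pose bad (c : R * R * R) := tilt_crossed l p q g c.1.1 c.1.2 c.2 s n.
pose V c w := if bad c w then W w else 0.
have V0 c w : 0 <= V c w by rewrite /V; case: ifP => // _; exact: expR_ge0.
have mV c : measurable_fun setT (fun w => (V c w)%:E).
  apply/measurable_EFinP; apply: measurable_fun_ifT => //.
  exact: measurable_tilt_crossed.
pose D w := ((expR K)%:E * (\1_A w)%:E)%E.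
have D0 w : (0 <= D w)%E by rewrite mule_ge0// lee_fin ?expR_ge0.
have m1A : measurable_fun setT (fun w => (\1_A w)%:E : \bar R).
  by apply/measurable_EFinP; exact: measurable_indic.
have mD : measurable_fun setT D by exact: measurable_funeM.
have DE : (\int[P]_w D w = (expR K)%:E * P A)%E.
  by rewrite ge0_integralZl ?lee_fin ?expR_ge0// integral_indic ?setIT.
pose VL w := (\sum_(c <- L) (V c w)%:E)%E.
have VL0 w : (0 <= VL w)%E by rewrite sume_ge0// => c _; rewrite lee_fin.
have mVL : measurable_fun setT VL by exact: emeasurable_sum.
have VL_le : (\int[P]_w VL w <= (2^-1)%:E)%E.
  rewrite /VL ge0_integral_sum//; last by move=> c w _; rewrite lee_fin.
  apply: (@le_trans _ _ (\sum_(c <- L) (expR (- s))%:E)%E).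
    rewrite big_seq [leRHS]big_seq; apply: lee_sum => c cL.
    exact: tilted_maximal_inequality (EL c cL).
  by rewrite sumEFin lee_fin big_const_seq count_predT iter_addr_0 -[leLHS]mulr_natl.
have W_le : (1 <= \int[P]_w (VL w + D w))%E.
  rewrite -W1; apply: ae_ge0_le_integral => //.
  - by move=> w _; rewrite lee_fin expR_ge0.
  - exact/measurable_EFinP.
  - by move=> w _; rewrite adde_ge0.
  - exact: emeasurable_funD.
  exists N; split => // w /= nle; apply: contrapT => nNw; apply: nle => _.
  have /= good := contra_notP (subN w) nNw.
  have [/hasP[c cL badc]|/hasPn noL] := boolP (has (bad^~ w) L).
    apply: lee_paddr => //; rewrite /VL (big_rem c)//= {1}/V badc leeDl//.
    by rewrite sume_ge0// => c' _; rewrite lee_fin.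
  have [c cL k kn|Aw lwK] := good; first exact: uncrossed_lt kn (noL c cL).
  apply: lee_paddl => //.
  by rewrite /D indicE mem_set// mule1 lee_fin ler_expR.
move: W_le; rewrite ge0_integralD// DE => W_le.
have {W_le}: (1 <= (2^-1)%:E + (expR K)%:E * P A)%E.
  by apply: (le_trans W_le); rewrite leeD2r.
rewrite -(@fineK _ (P A)) ?fin_num_measure// -EFinM -EFinD !lee_fin => h.
rewrite ler_pdivrMr// expRN -[leLHS]mulr1 ler_pdivrMl ?expR_gt0//; lra.
Qed.

Lemma lower_tail_bound (eps : R) : 0 < eps ->
  exists2 delta, 0 < delta & forall l t : R, 0 < l < delta -> 0 < t ->
  delta^-1 ^+ 2 < l ^+ 2 * t ->
  ((expR (- (2^-1 + eps) * (l ^+ 2 * t)))%:E <= P [set w | (l * t < S t w)%R])%E.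
Proof.
move=> eps0.
have [eta [eta0 eta12 etae]] : exists eta : R, [/\ 0 < eta, 12 * eta <= 1 & 12 * eta <= eps].
  exists (Num.min 1 eps / 12); rewrite (mulrC 12) mulfVK//; split.
  - by rewrite divr_gt0// lt_min ltr01.
  - by rewrite ge_min lexx.
  - by rewrite ge_min lexx orbT.
(* the drift exceeds 1 by enough to pay for a number of renewals as low as
   (1 - 2 eta) t and for the fluctuation of the rewards *)
pose p := 1 + 4 * eta; pose q := p ^+ 2 / 2; pose kappa := eta ^+ 2 / 8.
have kappa0 : 0 < kappa by rewrite divr_gt0// exprn_gt0.
have q12 : 2^-1 <= q by rewrite /q /p; have := sqr_ge0 eta; lra.
have q0 : 0 < q by lra.
have q1 : 0 < q + 1 by lra.
have q2 : 0 < q - 4^-1 by lra.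
have q4 : 0 < (1 + eta) * q by rewrite mulr_gt0// addr_gt0.
have [d0' d00 H0] := expectation_tilt p q0 kappa0.
have [d1 d10 H1] := expectation_tilt p q1 kappa0.
have [d2 d20 H2] := expectation_tilt p q2 kappa0.
have [d3 d30 H3] := expectation_tilt (p - eta) q0 kappa0.
have [d4 d40 H4] := expectation_tilt ((1 + eta) * p) q4 kappa0.
have eta40 : 0 < eta / 4 by rewrite divr_gt0.
have [delta [delta0 dee [de0 de1 de2 de3 de4]]] : exists delta : R,
    [/\ 0 < delta, delta <= eta / 4 &
    [/\ delta <= d0', delta <= d1, delta <= d2, delta <= d3 & delta <= d4]].
  exists (Num.min (eta / 4) (Num.min d0' (Num.min d1 (Num.min d2 (Num.min d3 d4))))).
  split; [by rewrite !lt_min eta40 d00 d10 d20 d30 d40|by rewrite ge_min lexx|].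
  by split; rewrite !ge_min lexx ?orbT.
exists delta => // l t l_itv t0 lt_large.
have [eta_x eta_t] := time_large eta0 eta12 delta0 dee l_itv lt_large.
have [l0 ld] := andP l_itv.
have below d' : delta <= d' -> 0 < l < d' by move=> dd'; rewrite l0 (lt_le_trans ld).
have {H0}[z0 Ez0 z0k] := H0 l (below _ de0).
have {H1}[z1 Ez1 z1k] := H1 l (below _ de1).
have {H2}[z2 Ez2 z2k] := H2 l (below _ de2).
have {H3}[z3 Ez3 z3k] := H3 l (below _ de3).
have {H4}[z4 Ez4 z4k] := H4 l (below _ de4).
have [g1 g2 g3 g4] := tilt_slack eta0 eta12 erefl z0k z1k z2k z3k z4k.
have [m [n [mn hm1 hm2 hn1 hn2]]] := renewal_counts eta0 eta12 eta_t t0.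
pose s := eta ^+ 2 * (l ^+ 2 * t) / 2.
have x0 : 0 <= l ^+ 2 * t by rewrite mulr_ge0 ?sqr_ge0 ?ltW.
have E1 i : (\int[P]_w (tilt l p q z0 (Y i w))%:E = 1)%E.
  by rewrite Ez0 subrr mulr0 expR0.
have super z g : z <= g -> expR (l ^+ 2 * (z - g)) <= 1.
  by move=> zg; rewrite expR_le1 mulr_ge0_le0 ?sqr_ge0// subr_le0.
have ex : 1 <= eta * (l ^+ 2 * t).
  have : 0 <= eta * (1 - eta) * (l ^+ 2 * t) by rewrite !mulr_ge0// ?ltW//; lra.
  lra.
apply: (@le_trans _ _ (expR (- ((2^-1 + 11 * eta) * (l ^+ 2 * t))) / 2)%:E).
  by rewrite lee_fin expR_half_le.
pose L := [:: (p, q + 1, z0 - (1 - eta / 4));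
              (p, q - 4^-1, z0 + 4^-1 * (1 + eta / 2));
              (p - eta, q, z0 - (p * eta - eta ^+ 2));
              ((1 + eta) * p, (1 + eta) * q, (1 + eta) * z0 + power_rate eta q)].
apply: (@tilted_lower_bound l p q z0 s _ n L) => //.
- move=> c; rewrite !inE => /or4P[] /eqP -> i /=.
  + by rewrite Ez1 lee_fin super.
  + by rewrite Ez2 lee_fin super.
  + by rewrite Ez3 lee_fin super.
  + by rewrite Ez4 lee_fin super.
- rewrite /= expRN ler_pdivrMr ?expR_gt0//.
  by have := expR_ge1Dx s; rewrite /s; lra.
apply: filterS S_process => w Sproc good.
(* no crossing by the four comparison products, at the times where each is used *)
have c1 := good _ (@mem_nth _ (0, 0, 0) L 0 isT) n (leqnn n).
have c2 := good _ (@mem_nth _ (0, 0, 0) L 1 isT) m mn.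
have c3 := good _ (@mem_nth _ (0, 0, 0) L 2 isT).
have c4 := good _ (@mem_nth _ (0, 0, 0) L 3 isT) n (leqnn n).
split; last exact: good_weight_le c4.
have Tm := good_time_le eta0 eta12 l0 t0 hm2 c2.
have Tn := good_time_gt eta0 eta12 l0 t0 hn1 c1.
have [|k [/andP[mk kn] _ /= ->]] :=
    renewal_value_between mn (fun k => Sproc t k (ltW t0)).
  by rewrite Tm Tn.
apply: good_reward_gt (c3 k kn) => //.
by apply: le_trans hm1 _; rewrite ler_nat.
Qed.

End renewal_reward.

(** * Moderate deviations *)

Theorem theorem1 (R : realType)
    (d0 : measure_display) (T0 : measurableType d0) (P0 : probability T0 R)
    (tau0 X0 : {RV P0 >-> R})
    (d : measure_display) (T : measurableType d) (P : probability T R)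
    (tau X : nat -> {RV P >-> R}) (S : R -> {RV P >-> R})
    (tau0_gt0 : {ae P0, forall w, 0 < tau0 w})
    (copies : independent_copies P0 P (fun w => (tau0 w, X0 w))
                (fun i w => (tau i w, X i w)))
    (S_process : renewal_reward_process P tau X S)
    (exp_moment : exists2 eps : R, 0 < eps &
       ('E_P0[fun w => expR (eps * X0 w ^+ 2 - tau0 w)] < +oo)%E)
    (mean_X : ('E_P0[X0] = 0)%E)
    (second_moment_X : ('E_P0[fun w => (X0 w ^+ 2)%R] = 1)%E)
    (mean_tau : ('E_P0[tau0] = 1)%E) :
  forall eps : R, 0 < eps ->
  exists2 delta : R, 0 < delta &
  forall t x : R, 0 < t -> 0 < x -> delta^-1 < x -> x / Num.sqrt t < delta ->
    (`| (x ^- 2)%:E * lne (P [set w | (x * Num.sqrt t < S t w)%R]) + (2^-1)%:E |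
       <= eps%:E)%E.
Proof.
move=> eps eps0.
have [d1 d10 upper] := upper_tail_bound tau0_gt0 copies S_process exp_moment
  mean_X second_moment_X mean_tau eps0.
have [d2 d20 lower] := lower_tail_bound tau0_gt0 copies S_process exp_moment
  mean_X second_moment_X mean_tau eps0.
exists (Num.min d1 d2); first by rewrite lt_min d10.
move=> t x t0 x0 x_large; rewrite lt_min => /andP[l1 l2].
pose l := x / Num.sqrt t.
have st0 : 0 < Num.sqrt t by rewrite sqrtr_gt0.
have tE : t = Num.sqrt t ^+ 2 by rewrite sqr_sqrtr// ltW.
have l0 : 0 < l by rewrite divr_gt0.
have ltE : l * t = x * Num.sqrt t by rewrite {1}tE /l; field; rewrite gt_eqF.
have l2tE : l ^+ 2 * t = x ^+ 2 by rewrite {1}tE /l; field; rewrite gt_eqF.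
have {}upper := upper l t; have {}lower := lower l t.
rewrite l0 l1 ltE l2tE in upper; rewrite l0 l2 ltE l2tE in lower.
have {}upper := upper isT t0.
have {}lower : ((expR (- (2^-1 + eps) * x ^+ 2))%:E <=
    P [set w | (x * Num.sqrt t < S t w)%R])%E.
  apply: lower => //; rewrite lterXn2r// ?nnegrE ?invr_ge0 ?(ltW d20) ?(ltW x0)//.
  apply: le_lt_trans x_large; rewrite lef_pV2 ?posrE ?lt_min ?d10//.
  by rewrite ge_min lexx orbT.
set Pr := P _ in upper lower *.
have Pfin : Pr \is a fin_num.
  by rewrite fin_real// (lt_le_trans _ lower) ?ltNyr// (le_lt_trans upper) ?ltry.
move: upper lower; rewrite -(fineK Pfin) !lee_fin; set a := fine Pr => upper lower.
have a0 : 0 < a by apply: lt_le_trans lower; exact: expR_gt0.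
have lnU : ln a <= - (2^-1 - eps) * x ^+ 2 by rewrite -ler_expR lnK ?posrE.
have lnL : - (2^-1 + eps) * x ^+ 2 <= ln a by rewrite -ler_expR lnK ?posrE.
have x20 : 0 < x ^+ 2 by rewrite exprn_gt0.
rewrite lne_EFin// -EFinM -EFinD abse_EFin lee_fin.
have -> : x ^- 2 * ln a + 2^-1 = (ln a + 2^-1 * x ^+ 2) / x ^+ 2.
  by field; rewrite gt_eqF.
rewrite normrM normfV (gtr0_norm x20) ler_pdivrMr// ler_norml; lra.
Qed.
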